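(* Let $\gamma=\gamma(z)$ be a function with $\gamma(1)\ne0$, let $g$ be a function that satisfies $g=1+z\gamma(g)$, and let $f=z\dfrac{\gamma(g)}{g\,\gamma(1/g)}$. Then $$B_f=H\circ\overline{\left(\frac{z}{\eta}\right)},$$ where the power series $H=H(z)$ and $\eta=\eta(z)$ are defined by $$\eta\left(\frac{(z-1)^2}{z}\right)=\gamma(z)\,\gamma\left(\frac1z\right),\qquad H\left(\frac{(z-1)^2}{z}\right)=\frac{\gamma(z)-z\gamma\left(\frac1z\right)}{z-1}.$$
   Context: All power series have real coefficients. The overline denotes compositional inverse of a formal power series of order exactly $1$. The function $\gamma$, not necessarily a generalized palindrome, is understood through its power series expansion at $z=1$, i.e. $\gamma(1+w)\in\mathbb{R}[[w]]$ with nonzero constant term $\gamma(1)$, so that $\gamma(a(z))$ is a formal power series whenever $a(0)=1$; $g$ is a formal power series with $g(0)=1$. The defining identities for $\eta$ and $H$ are identities of power series in $z-1$. The function $f$ is the pseudo-involutory companion of $g$, i.e. the Riordan array $(g,f)$ is a pseudo-involution: $g\circ(-f)=1/g$ and $-f$ is a compositional involution. The B-function $B_f\in\mathbb{R}[[z]]$ of $f$ is defined by $f-z=zf\,B_f(zf)$, i.e. $f-z=(zB_f)\circ(zf)$. *)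

(* Defs.v *)
From HB Require Import structures.
From mathcomp Require Import all_boot all_algebra.
From mathcomp Require Import boolp classical_sets.

Set Implicit Arguments.
Unset Strict Implicit.
Unset Printing Implicit Defensive.

Import GRing.Theory.
Local Open Scope ring_scope.

(* A formal power series is its sequence of coefficients: [f n] is the
   coefficient of z^n. It is wrapped in a record so that [*] is the Cauchy
   product and not the pointwise product of functions. *)
Record fps (K : Type) := Fps { fps_coef :> nat -> K }.

Lemma fpsP (K : Type) (f g : fps K) : f =1 g -> f = g.
Proof. by case: f => f; case: g => g /= /funext ->. Qed.

HB.instance Definition _ (K : Type) := gen_eqMixin (fps K).
HB.instance Definition _ (K : Type) := gen_choiceMixin (fps K).

Section Ring.
Variable K : fieldType.
Implicit Types f g h : fps K.

Definition fps_zero : fps K := Fps (fun _ => 0).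
Definition fps_opp f : fps K := Fps (fun n => - f n).
Definition fps_add f g : fps K := Fps (fun n => f n + g n).

Fact fps_addA : associative fps_add.
Proof. by move=> f g h; apply: fpsP => n /=; rewrite addrA. Qed.
Fact fps_addC : commutative fps_add.
Proof. by move=> f g; apply: fpsP => n /=; rewrite addrC. Qed.
Fact fps_add0 : left_id fps_zero fps_add.
Proof. by move=> f; apply: fpsP => n /=; rewrite add0r. Qed.
Fact fps_addN : left_inverse fps_zero fps_opp fps_add.
Proof. by move=> f; apply: fpsP => n /=; rewrite addNr. Qed.

HB.instance Definition _ :=
  GRing.isZmodule.Build (fps K) fps_addA fps_addC fps_add0 fps_addN.

Definition fps_one : fps K := Fps (fun n => (n == 0%N)%:R).
Definition fps_mul f g : fps K := Fps (fun n => \sum_(i < n.+1) f i * g (n - i)%N).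

Definition fps_trunc N f : {poly K} := \poly_(i < N) f i.

Lemma coef_fps_trunc N f n : (n < N)%N -> (fps_trunc N f)`_n = f n.
Proof. by move=> ltnN; rewrite coef_poly ltnN. Qed.

Lemma fps_mul_trunc N f g n : (n < N)%N ->
  fps_mul f g n = (fps_trunc N f * fps_trunc N g)`_n.
Proof.
move=> ltnN; rewrite coefM /=; apply: eq_bigr => i _.
rewrite !coef_fps_trunc //; first exact: leq_ltn_trans (leq_subr _ _) ltnN.
exact: leq_trans (ltn_ord i) ltnN.
Qed.

Fact fps_mulC : commutative fps_mul.
Proof.
by move=> f g; apply: fpsP => n; rewrite !(@fps_mul_trunc n.+1) // mulrC.
Qed.
Fact fps_mulA : associative fps_mul.
Proof.
move=> f g h; apply: fpsP => n.
transitivity (fps_trunc n.+1 f * (fps_trunc n.+1 g * fps_trunc n.+1 h))`_n.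
  rewrite coefM; apply: eq_bigr => i _; rewrite coef_fps_trunc //.
  by rewrite (@fps_mul_trunc n.+1) // ltnS leq_subr.
rewrite mulrA coefM; apply: eq_bigr => i _.
by rewrite (@fps_mul_trunc n.+1) // coef_fps_trunc // ltnS leq_subr.
Qed.
Fact fps_mul1 : left_id fps_one fps_mul.
Proof.
move=> f; apply: fpsP => n /=; rewrite big_ord_recl /= mul1r subn0 big1 ?addr0 //.
by move=> i _; rewrite mul0r.
Qed.
Fact fps_mulDl : left_distributive fps_mul fps_add.
Proof.
move=> f g h; apply: fpsP => n /=; rewrite -big_split /=.
by apply: eq_bigr => i _; rewrite mulrDl.
Qed.
Fact fps_one_neq0 : fps_one != 0.
Proof. by apply/eqP => /(congr1 (fun f : fps K => f 0%N))/eqP; rewrite oner_eq0. Qed.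

HB.instance Definition _ := GRing.Zmodule_isComNzRing.Build (fps K)
  fps_mulA fps_mulC fps_mul1 fps_mulDl fps_one_neq0.

Lemma coef_fps0 n : (0 : fps K) n = 0. Proof. by []. Qed.
Lemma coef_fps1 n : (1 : fps K) n = (n == 0%N)%:R. Proof. by []. Qed.
Lemma coef_fpsN f n : (- f) n = - f n. Proof. by []. Qed.
Lemma coef_fpsD f g n : (f + g) n = f n + g n. Proof. by []. Qed.
Lemma coef_fpsM f g n : (f * g) n = \sum_(i < n.+1) f i * g (n - i)%N.
Proof. by []. Qed.

(* The first n coefficients of 1/f, each one obtained from the previous ones
   by comparing coefficients in (1/f) * f = 1. *)
Fixpoint fps_inv_prefix f n : seq K :=
  if n is m.+1 then
    let s := fps_inv_prefix f m in
    rcons s ((f 0%N)^-1 * ((m == 0%N)%:R - \sum_(k < m) s`_k * f (m - k)%N))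
  else [::].

Definition fps_unit : pred (fps K) := fun f => f 0%N != 0.
Definition fps_inv f : fps K :=
  if f \in fps_unit then Fps (fun n => (fps_inv_prefix f n.+1)`_n) else f.

Lemma size_fps_inv_prefix f n : size (fps_inv_prefix f n) = n.
Proof. by elim: n => //= n IHn; rewrite size_rcons IHn. Qed.

Lemma nth_fps_inv_prefix f n k :
  (k < n)%N -> (fps_inv_prefix f n)`_k = (fps_inv_prefix f k.+1)`_k.
Proof.
elim: n => // n IHn; rewrite ltnS leq_eqVlt => /predU1P[-> //|ltkn].
by rewrite [fps_inv_prefix f n.+1]/= nth_rcons size_fps_inv_prefix ltkn IHn.
Qed.

Fact fps_mulVx : {in fps_unit, left_inverse 1 fps_inv *%R}.
Proof.
move=> f f_unit; apply: fpsP => n; rewrite /fps_inv f_unit coef_fpsM coef_fps1.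
rewrite big_ord_recr /= subnn nth_rcons size_fps_inv_prefix ltnn eqxx.
rewrite (_ : \sum_(i < n) _ = \sum_(k < n) (fps_inv_prefix f n)`_k * f (n - k)%N).
  by rewrite mulrAC mulVf // mul1r addrC subrK.
by apply: eq_bigr => i _; rewrite [in RHS]nth_fps_inv_prefix.
Qed.

Fact fps_unitPl f g : g * f = 1 -> f \in fps_unit.
Proof.
move=> /(congr1 (fun h : fps K => h 0%N)); rewrite coef_fpsM big_ord1 coef_fps1.
move=> gf1; apply/eqP => f0.
by move: gf1; rewrite /= subnn f0 mulr0 => /esym/eqP; rewrite oner_eq0.
Qed.

Fact fps_inv_out : {in [predC fps_unit], fps_inv =1 id}.
Proof. by move=> f /negPf f_nonunit; rewrite /fps_inv f_nonunit. Qed.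

HB.instance Definition _ := GRing.ComNzRing_hasMulInverse.Build (fps K)
  fps_mulVx fps_unitPl fps_inv_out.

Lemma fps_unitE f : (f \is a GRing.unit) = (f 0%N != 0).
Proof. by []. Qed.

Definition fpsX : fps K := Fps (fun n => (n == 1%N)%:R).

(* f(g(z)). This is the composition only when g 0 = 0: then g ^+ k has order at
   least k, so that only the terms with k <= n contribute to z^n. *)
Definition fps_comp f g : fps K :=
  Fps (fun n => \sum_(k < n.+1) f k * (g ^+ k) n).

(* The compositional inverse, meaningful when f has order exactly 1. *)
Definition fps_cinv f : fps K :=
  xget 0 [set h : fps K |
    [/\ h 0%N = 0, fps_comp f h = fpsX & fps_comp h f = fpsX]]%classic.

End Ring.

Arguments fpsX {K}.

Notation "f \oF g" := (fps_comp f g) (at level 50, left associativity) : ring_scope.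

Section PseudoInvolution.
Variable K : fieldType.
Implicit Types f g gamma eta H B : fps K.

(* The Riordan array (g, f) is a pseudo-involution. *)
Definition pseudo_involution g f : Prop :=
  [/\ g 0%N != 0, f 0%N = 0, g \oF (- f) = g^-1 & (- f) \oF (- f) = fpsX].

(* B is the B-function of f: f - z = (z B) o (z f). *)
Definition is_B_function f B : Prop :=
  f - fpsX = (fpsX * B) \oF (fpsX * f).

(* A function gamma is given by its expansion at 1: the argument gamma below is
   the power series gamma(1 + w) in w, hence gamma 0 is the value gamma(1).
   Then gamma(a(z)) is a power series whenever a 0 = 1. *)
Definition eval_at gamma a : fps K := gamma \oF (a - 1).

(* The variable z of the identities that define eta and H, as a power series in
   w = z - 1. *)
Definition z_at1 : fps K := 1 + fpsX.

Definition eta_identity gamma eta : Prop :=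
  eta \oF ((z_at1 - 1) ^+ 2 / z_at1) =
  eval_at gamma z_at1 * eval_at gamma z_at1^-1.

(* z - 1 is not invertible among the power series in z - 1, hence the quotient
   by z - 1 is written as a product; it determines H o ((z - 1)^2 / z) since
   power series form an integral domain. *)
Definition H_identity gamma H : Prop :=
  (z_at1 - 1) * (H \oF ((z_at1 - 1) ^+ 2 / z_at1)) =
  eval_at gamma z_at1 - z_at1 * eval_at gamma z_at1^-1.

End PseudoInvolution.

Arguments z_at1 {K}.

(* Main.v *)
(* Put [u = g - 1] and [P = w / gamma(1 + w)]: the equation for [g] says that [P]
   and [u] are compositional inverses, and the formula for [f] says that [- f] is
   the conjugate by [P] of [sigma : w |-> - w / (1 + w)], which is [z |-> 1/z] in
   the variable [w = z - 1]. Hence [(g, f)] is a pseudo-involution.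
   With [T = (z - 1)^2 / z], a power series in [w] is a power series in [T] exactly
   when it is invariant under [sigma]; this gives [eta] and [H].
   Composing on the right with [P] turns [z f] into [E o T], where [E = z / eta],
   and [f - z] into [(E H) o T], so that the equation for [B] becomes
   [H = B o E]. *)
Require Import Defs.
From mathcomp Require Import all_boot all_algebra reals.
From mathcomp Require Import boolp classical_sets ring.

Set Implicit Arguments.
Unset Strict Implicit.
Unset Printing Implicit Defensive.

Import GRing.Theory Num.Theory.
Local Open Scope ring_scope.

(** * The algebra of composition of formal power series *)

Section Composition.
Variable K : fieldType.
Implicit Types (c : K) (f g h A B : fps K).

Definition fps_const c : fps K := Fps (fun n => c *+ (n == 0%N)).
Definition fps_shift f : fps K := Fps (fun n => f n.+1).

Lemma coef_fpsM0 f g : (f * g) 0%N = f 0%N * g 0%N.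
Proof. by rewrite coef_fpsM big_ord1 subnn. Qed.

Lemma coef_fpsV0 f : f 0%N != 0 -> f^-1 0%N = (f 0%N)^-1.
Proof.
move=> f0; apply: (mulfI f0); rewrite -coef_fpsM0 divrr ?fps_unitE //.
by rewrite coef_fps1 divff.
Qed.

Lemma coef_fpsXM f n : (fpsX * f) n.+1 = f n.
Proof.
rewrite coef_fpsM !big_ord_recl /= mul0r add0r mul1r subSS subn0 big1 ?addr0 //.
by move=> i _; rewrite mul0r.
Qed.

Lemma coef_fpsXM0 f : (fpsX * f) 0%N = 0.
Proof. by rewrite coef_fpsM0 mul0r. Qed.

Lemma coef_fps_constM c f n : (fps_const c * f) n = c * f n.
Proof.
rewrite coef_fpsM big_ord_recl /= subn0 mulr1n big1 ?addr0 // => i _.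
by rewrite mulr0n mul0r.
Qed.

Lemma fps_shiftE f : f = fps_const (f 0%N) + fpsX * fps_shift f.
Proof.
apply: fpsP => -[|n]; rewrite coef_fpsD ?coef_fpsXM ?coef_fpsXM0 /=.
  by rewrite addr0.
by rewrite add0r.
Qed.

Lemma fps_shiftK f : f 0%N = 0 -> fpsX * fps_shift f = f.
Proof.
by move=> f0; apply: fpsP => -[|n]; rewrite ?coef_fpsXM ?coef_fpsXM0.
Qed.

Lemma fpsX_lreg : GRing.lreg (fpsX : fps K).
Proof.
move=> f g fg; apply: fpsP => n.
by rewrite -(coef_fpsXM f) fg coef_fpsXM.
Qed.

(** Drives the coefficientwise inductions below: a factor without constant term delays the other
    factor by at least one degree. *)
Lemma coef_fpsM_lt f A B n : f 0%N = 0 ->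
  (forall m, (m < n)%N -> A m = B m) -> (f * A) n = (f * B) n.
Proof.
move=> f0 AB; rewrite !coef_fpsM !big_ord_recl f0 !mul0r; congr (_ + _).
by apply: eq_bigr => i _; rewrite AB // lift0 ltn_subrL (leq_ltn_trans _ (ltn_ord i)).
Qed.

Lemma coef_fpsX_lt g k n : g 0%N = 0 -> (n < k)%N -> (g ^+ k) n = 0.
Proof.
move=> g0; elim: k n => // k IHk n; rewrite ltnS => lenk.
rewrite exprS (@coef_fpsM_lt _ _ 0) ?mulr0 //.
by move=> m ltmn; rewrite IHk // (leq_trans ltmn).
Qed.

(** Since [g ^+ k] has order at least [k], extra terms vanish, so coefficients of different degrees
    can be written with one common summation range. *)
Lemma coef_fps_comp f g n N : g 0%N = 0 -> (n < N)%N ->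
  (f \oF g) n = \sum_(k < N) f k * (g ^+ k) n.
Proof.
move=> g0 ltnN; rewrite [LHS]/= (big_ord_widen _ (fun k => f k * (g ^+ k) n) ltnN).
rewrite big_mkcond; apply: eq_bigr => k _; case: ltnP => // ltnk.
by rewrite coef_fpsX_lt ?mulr0.
Qed.

(** One Horner step; it is the recursion behind multiplicativity, associativity and cancellation of
    composition. *)
Lemma fps_compE f g : g 0%N = 0 ->
  f \oF g = fps_const (f 0%N) + g * (fps_shift f \oF g).
Proof.
move=> g0; apply: fpsP => n; rewrite coef_fpsD [LHS]/= big_ord_recl; congr (_ + _).
  by rewrite expr0 coef_fps1 /= mulr_natr.
rewrite coef_fpsM.
rewrite (eq_bigr (fun k : 'I_n => \sum_(i < n.+1)
  g i * (f k.+1 * (g ^+ k) (n - i)%N))); last first.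
  move=> k _; rewrite lift0 exprS coef_fpsM mulr_sumr.
  by apply: eq_bigr => i _; rewrite mulrCA.
rewrite exchange_big /=; apply: eq_bigr => -[[|i] /= lti] _.
  by rewrite g0 mul0r big1 // => k _; rewrite mul0r.
rewrite -mulr_sumr -(@coef_fps_comp (fps_shift f) g _ n) // ltn_subrL.
exact: leq_trans (ltn0Sn i) lti.
Qed.

Lemma coef_fps_comp0 f g : (f \oF g) 0%N = f 0%N.
Proof. by rewrite /= big_ord1 expr0 coef_fps1 mulr1. Qed.

Lemma coef_fps_comp1 f g : (f \oF g) 1%N = f 1%N * g 1%N.
Proof. by rewrite /= !big_ord_recl big_ord0 expr0 expr1 coef_fps1 mulr0 add0r addr0. Qed.

Lemma fps_compD f h g : (f + h) \oF g = (f \oF g) + (h \oF g).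
Proof.
by apply: fpsP => n /=; rewrite -big_split; apply: eq_bigr => k _; rewrite mulrDl.
Qed.

Lemma fps_compN f g : (- f) \oF g = - (f \oF g).
Proof.
by apply: fpsP => n /=; rewrite -sumrN; apply: eq_bigr => k _; rewrite mulNr.
Qed.

Lemma fps_compB f h g : (f - h) \oF g = (f \oF g) - (h \oF g).
Proof. by rewrite fps_compD fps_compN. Qed.

Lemma fps_comp_constM c f g : (fps_const c * f) \oF g = fps_const c * (f \oF g).
Proof.
apply: fpsP => n; rewrite coef_fps_constM mulr_sumr; apply: eq_bigr => k _.
by rewrite coef_fps_constM mulrA.
Qed.

Lemma fps_comp1 g : 1 \oF g = 1.
Proof.
apply: fpsP => n; rewrite /= big_ord_recl expr0 coef_fps1 eqxx mul1r big1 ?addr0 //.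
by move=> k _; rewrite mul0r.
Qed.

Lemma fps_compXM f g : g 0%N = 0 -> (fpsX * f) \oF g = g * (f \oF g).
Proof.
move=> g0; rewrite fps_compE // coef_fpsXM0.
have -> : fps_shift (fpsX * f) = f by apply: fpsP => n; rewrite /= -coef_fpsXM.
have -> : fps_const 0 = 0 by apply: fpsP => n; rewrite /= mul0rn.
by rewrite add0r.
Qed.

Lemma fps_comp_X g : g 0%N = 0 -> fpsX \oF g = g.
Proof. by move=> g0; rewrite -[fpsX]mulr1 fps_compXM // fps_comp1 mulr1. Qed.

(** Strong induction on the degree for all [f] at once: a Horner step on [f] leaves the factor [g],
    which lowers the degree. *)
Lemma fps_compM f h g : g 0%N = 0 -> (f * h) \oF g = (f \oF g) * (h \oF g).
Proof.
move=> g0; apply: fpsP => n; elim/ltn_ind: n f => n IHn f.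
rewrite {1}(fps_shiftE f) mulrDl fps_compD fps_comp_constM -mulrA fps_compXM //.
rewrite (fps_compE f) // mulrDl -mulrA !coef_fpsD; congr (_ + _).
by apply: coef_fpsM_lt => // m ltmn; rewrite IHn.
Qed.

Lemma fps_compX f k g : g 0%N = 0 -> (f ^+ k) \oF g = (f \oF g) ^+ k.
Proof.
by move=> g0; elim: k => [|k IHk]; rewrite ?fps_comp1 // !exprS fps_compM // IHk.
Qed.

Lemma fps_compV f g : f 0%N != 0 -> g 0%N = 0 -> f^-1 \oF g = (f \oF g)^-1.
Proof.
move=> f0 g0; have fg_unit : f \oF g \is a GRing.unit.
  by rewrite fps_unitE coef_fps_comp0.
by apply: (mulrI fg_unit); rewrite -fps_compM // !divrr ?fps_comp1.
Qed.

Lemma fps_compA f g h : g 0%N = 0 -> h 0%N = 0 -> (f \oF g) \oF h = f \oF (g \oF h).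
Proof.
move=> g0 h0; have gh0 : (g \oF h) 0%N = 0 by rewrite coef_fps_comp0.
apply: fpsP => n; elim/ltn_ind: n f => n IHn f.
rewrite (fps_compE f g0) (fps_compE f gh0) fps_compD fps_compM // !coef_fpsD.
congr (_ + _); last by apply: coef_fpsM_lt => // m ltmn; rewrite IHn.
by rewrite -[fps_const _]mulr1 fps_comp_constM fps_comp1.
Qed.

Lemma fps_comp_id f : f \oF fpsX = f.
Proof.
apply: fpsP => n; elim: n f => [|n IHn] f; first by rewrite coef_fps_comp0.
by rewrite fps_compE // coef_fpsD coef_fpsXM IHn /= add0r.
Qed.

(** The constant terms agree, and cancelling [g] in the Horner step passes the equality on to the
    shifted series. *)
Lemma fps_comp_inj g : g 0%N = 0 -> GRing.lreg g -> injective (fun f => f \oF g).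
Proof.
move=> g0 reg_g f h /= fh; apply: fpsP => n; elim: n f h fh => [|n IHn] f h fh.
  by rewrite -(coef_fps_comp0 f g) fh coef_fps_comp0.
apply: (IHn (fps_shift f) (fps_shift h)); apply: reg_g.
move: (fh); rewrite (fps_compE f) // (fps_compE h) //.
rewrite -(coef_fps_comp0 f g) fh coef_fps_comp0; exact: addrI.
Qed.

(* Expanding [A] by repeated division by [g]: the successive constant terms are
   the coefficients of [h]. *)
Lemma fps_comp_surj (S : fps K -> Prop) g : g 0%N = 0 ->
    (forall A, S A -> exists2 A', S A' & A = fps_const (A 0%N) + g * A') ->
  forall A, S A -> exists h, h \oF g = A.
Proof.
move=> g0 divS A SA.
have /choice[q qP] : forall B : fps K, exists B',
    S B -> S B' /\ B = fps_const (B 0%N) + g * B'.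
  move=> B; have [/divS[B' SB' BE]|nSB] := pselect (S B); first by exists B'.
  by exists 0.
have Sq i : S (iter i q A) by elim: i => //= i IHi; have [] := qP _ IHi.
exists (Fps (fun i => iter i q A 0%N)); apply: fpsP => n.
(* Generalized to every tail of the expansion, because a Horner step moves from the [i]-th quotient
   to the next. *)
suff coefE i : (Fps (fun k => iter (i + k) q A 0%N) \oF g) n = iter i q A n.
  exact: coefE 0%N.
elim/ltn_ind: n i => n IHn i; have [_ ->] := qP _ (Sq i).
rewrite fps_compE // !coef_fpsD; congr (_ + _); first by rewrite /= addn0.
apply: coef_fpsM_lt => // m ltmn; rewrite -(IHn _ ltmn i.+1).
by congr ((_ \oF _) _); apply: fpsP => k /=; rewrite addnS.
Qed.

(** * Compositional inverses of series of order one *)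

Lemma fps_order1E f : f 0%N = 0 -> f 1%N != 0 ->
  exists2 h, h \is a GRing.unit & f = fpsX * h.
Proof. by move=> f0 f1; exists (fps_shift f); rewrite ?fps_unitE ?fps_shiftK. Qed.

(** As [f] is [fpsX] times a unit, any series minus its constant term is divisible by [f]; so [fpsX]
    expands in powers of [f]. *)
Lemma fps_comp_linv f : f 0%N = 0 -> f 1%N != 0 ->
  exists h, h 0%N = 0 /\ h \oF f = fpsX.
Proof.
move=> f0 f1; have [v v_unit fE] := fps_order1E f0 f1.
have [|h hf] := @fps_comp_surj (fun=> True) f f0 _ fpsX I.
  move=> A _; exists (v^-1 * fps_shift A) => //.
  by rewrite fE -mulrA mulVKr // -fps_shiftE.
by exists h; split; rewrite // -(coef_fps_comp0 h f) hf.
Qed.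

(** Both sides agree after composition on the right with [f], which is cancellable. *)
Lemma fps_comp_linv_rinv f h : f 0%N = 0 -> f 1%N != 0 -> h 0%N = 0 ->
  h \oF f = fpsX -> f \oF h = fpsX.
Proof.
move=> f0 f1 h0 hf; have [v v_unit fE] := fps_order1E f0 f1.
have reg_f : GRing.lreg f.
  by rewrite fE; apply: lregM; [exact: fpsX_lreg | exact: mulrI].
apply: (fps_comp_inj f0 reg_f).
by rewrite fps_compA // hf fps_comp_id fps_comp_X.
Qed.

Lemma fps_cinvP f : f 0%N = 0 -> f 1%N != 0 ->
  [/\ fps_cinv f 0%N = 0, f \oF fps_cinv f = fpsX & fps_cinv f \oF f = fpsX].
Proof.
move=> f0 f1; have [h [h0 hf]] := fps_comp_linv f0 f1.
apply: (@xgetPex _ 0 [set k : fps K |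
  [/\ k 0%N = 0, f \oF k = fpsX & k \oF f = fpsX]]%classic).
by exists h; split=> //; exact: fps_comp_linv_rinv.
Qed.

End Composition.

(** * The involution z -> 1/z near z = 1 and its invariant series *)

Section Reciprocal.
Variable K : fieldType.
Implicit Types A : fps K.

(* With [z = 1 + w], the map [z |-> 1/z] and the series [(z - 1)^2 / z] in [w]. *)
Definition recip1 : fps K := z_at1^-1 - 1.
Definition recip_quot : fps K := fpsX ^+ 2 / z_at1.

Lemma z_at1_0 : z_at1 0%N = 1 :> K.
Proof. by rewrite coef_fpsD coef_fps1 addr0. Qed.

Lemma z_at1_unit : (z_at1 : fps K) \is a GRing.unit.
Proof. by rewrite fps_unitE z_at1_0 oner_eq0. Qed.

Lemma z_at1B1 : z_at1 - 1 = fpsX :> fps K.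
Proof. by rewrite /z_at1 addrC addKr. Qed.

Lemma recip1E : recip1 = - fpsX / z_at1.
Proof.
by apply: (mulIr z_at1_unit); rewrite mulrBl divrK ?mulVr ?z_at1_unit //
  /z_at1 mul1r opprD addNKr.
Qed.

Lemma recip1_0 : recip1 0%N = 0.
Proof. by rewrite recip1E mulNr coef_fpsN coef_fpsXM0 oppr0. Qed.

Lemma z_at1_recip1 : z_at1 \oF recip1 = z_at1^-1.
Proof.
by rewrite /z_at1 fps_compD fps_comp1 fps_comp_X ?recip1_0 // addrC subrK.
Qed.

Lemma recip1K : recip1 \oF recip1 = fpsX.
Proof.
rewrite {1}/recip1 fps_compB fps_comp1 fps_compV ?recip1_0 ?z_at1_0 ?oner_eq0 //.
by rewrite z_at1_recip1 invrK z_at1B1.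
Qed.

Lemma recip_quot0 : recip_quot 0%N = 0.
Proof. by rewrite /recip_quot expr2 -mulrA coef_fpsXM0. Qed.

Lemma recip_quot_recip1 : recip_quot \oF recip1 = recip_quot.
Proof.
rewrite /recip_quot fps_compM ?fps_compX ?fps_compV ?recip1_0 ?z_at1_0 ?oner_eq0 //.
rewrite fps_comp_X ?recip1_0 // z_at1_recip1 invrK recip1E.
by rewrite exprMn sqrrN -mulrA [_^-1 ^+ 2]expr2 divrK ?z_at1_unit.
Qed.

Lemma recip_quot_lreg : GRing.lreg recip_quot.
Proof.
rewrite /recip_quot expr2; apply: lregM; first by apply: lregM; exact: fpsX_lreg.
by apply: mulrI; rewrite unitrV z_at1_unit.
Qed.

Lemma fps_comp_recip_quot_inj : injective (fun f => f \oF recip_quot).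
Proof. exact: (fps_comp_inj recip_quot0 recip_quot_lreg). Qed.

(* An invariant series has no linear term, because [recip1 = - w + ...]. *)
Lemma recip1_invariant_comp A : (2 : K) != 0 -> A \oF recip1 = A ->
  exists h, h \oF recip_quot = A.
Proof.
move=> two_neq0; move: A.
apply: (@fps_comp_surj _ (fun A => A \oF recip1 = A)) => [|A inv_A].
  exact: recip_quot0.
have A1 : A 1%N = 0.
  have /(congr1 (fun f : fps K => f 1%N)) := inv_A.
  rewrite coef_fps_comp1 recip1E mulNr coef_fpsN coef_fpsXM coef_fpsV0 z_at1_0
    ?oner_eq0 // invr1 mulrN1 => /eqP.
  (* The linear coefficients give [- A 1 = A 1], which forces zero since 2 is nonzero. *)
  rewrite eq_sym -subr_eq0 opprK -mulr2n -mulr_natr mulf_eq0 (negPf two_neq0).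
  by rewrite orbF => /eqP.
(* The factor [z_at1] compensates the denominator in [recip_quot]. *)
pose A' := z_at1 * fps_shift (fps_shift A).
have AE : A = fps_const (A 0%N) + recip_quot * A'.
  rewrite {1}[A]fps_shiftE; congr (_ + _).
  rewrite /recip_quot /A' -mulrA mulKr ?z_at1_unit //.
  by rewrite expr2 -mulrA; congr (_ * _); rewrite fps_shiftK.
(* The quotient inherits invariance: [A], its constant term and [recip_quot] are invariant, and
   [recip_quot] can be cancelled. *)
exists A' => //; apply: recip_quot_lreg; apply: (@addrI _ (fps_const (A 0%N))).
rewrite -[in RHS]AE -[in RHS]inv_A [in RHS]AE fps_compD.
rewrite fps_compM ?recip1_0 // recip_quot_recip1; congr (_ + _).
by rewrite -[fps_const _]mulr1 fps_comp_constM fps_comp1.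
Qed.

End Reciprocal.

(** * The companion [f], the series [eta] and [H], and the B-function *)

Section BFunction.
Variables (K : fieldType) (gamma g f : fps K).
Hypotheses (two_neq0 : (2 : K) != 0) (gamma1_neq0 : gamma 0%N != 0)
  (g0 : g 0%N = 1) (gE : g = 1 + fpsX * eval_at gamma g)
  (fE : f = fpsX * (eval_at gamma g / (g * eval_at gamma g^-1))).

(** The series of gamma(1/z) in w = z - 1. *)
Let gammaV : fps K := gamma \oF recip1 K.
Let u : fps K := g - 1.
Let P : fps K := fpsX / gamma.

Let gamma_unit : gamma \is a GRing.unit. Proof. by rewrite fps_unitE. Qed.

Let gammaV_unit : gammaV \is a GRing.unit.
Proof. by rewrite fps_unitE coef_fps_comp0. Qed.

Let u0 : u 0%N = 0.
Proof. by rewrite /u coef_fpsD coef_fpsN coef_fps1 g0 subrr. Qed.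

Let P0 : P 0%N = 0. Proof. exact: coef_fpsXM0. Qed.

Let uE : u = fpsX * (gamma \oF u).
Proof. by rewrite {1}/u {1}gE addrC addKr. Qed.

Let Pu : P \oF u = fpsX.
Proof.
rewrite /P fps_compM // fps_compV // fps_comp_X // {1}uE mulrK //.
by rewrite fps_unitE coef_fps_comp0.
Qed.

Let P1 : P 1%N != 0.
Proof. by rewrite coef_fpsXM coef_fpsV0 // invr_eq0. Qed.

Let uP : u \oF P = fpsX.
Proof.
apply: fps_comp_linv_rinv => //; rewrite uE coef_fpsXM coef_fps_comp0 //.
Qed.

Let gu : g = z_at1 \oF u.
Proof. by rewrite /z_at1 fps_compD fps_comp1 fps_comp_X // addrC subrK. Qed.

Let gVu : g^-1 - 1 = recip1 K \oF u.
Proof.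
by rewrite /recip1 fps_compB fps_comp1 fps_compV ?z_at1_0 ?oner_eq0 // -gu.
Qed.

Let NfE : - f = P \oF (recip1 K \oF u).
Proof.
have r0 := recip1_0 K; have z_unit := z_at1_unit K.
rewrite -fps_compA // /P fps_compM // fps_compV // fps_comp_X //.
rewrite -/gammaV recip1E fps_compM // fps_compM // fps_compN fps_comp_X //.
rewrite !fps_compV ?z_at1_0 ?oner_eq0 // ?coef_fps_comp0 // -gu.
rewrite fE /eval_at gVu -fps_compA // -/gammaV -/u.
rewrite invrM ?fps_unitE ?g0 ?oner_eq0 ?coef_fps_comp0 //.
(* Groups the factors of [f] so that the equation for [u] applies. *)
transitivity (- (fpsX * (gamma \oF u)) / g / (gammaV \oF u)); first by ring.
by rewrite -uE.
Qed.

Let ru0 : (recip1 K \oF u) 0%N = 0.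
Proof. by rewrite coef_fps_comp0 recip1_0. Qed.

Let Nf0 : (- f) 0%N = 0.
Proof. by rewrite NfE coef_fps_comp0. Qed.

Let f0 : f 0%N = 0.
Proof. by rewrite fE coef_fpsXM0. Qed.

Lemma companion_pseudo_involution : pseudo_involution g f.
Proof.
have r0 := recip1_0 K.
(* [u] intertwines [- f] with [recip1], so both conditions reduce to facts about z -> 1/z. *)
have uf : u \oF (- f) = recip1 K \oF u.
  by rewrite NfE -fps_compA // uP fps_comp_X.
split=> //; first by rewrite g0 oner_eq0.
  rewrite {1}gu fps_compA // uf -fps_compA // z_at1_recip1.
  by rewrite fps_compV ?z_at1_0 ?oner_eq0 // -gu.
rewrite {1}NfE fps_compA // fps_compA // uf.
by rewrite -(@fps_compA _ (recip1 K)) // recip1K fps_comp_X.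
Qed.

Let evalE : eval_at gamma z_at1 = gamma.
Proof. by rewrite /eval_at z_at1B1 fps_comp_id. Qed.

Let gammaVK : gammaV \oF recip1 K = gamma.
Proof. by rewrite /gammaV fps_compA ?recip1_0 // recip1K fps_comp_id. Qed.

Lemma eta_identityE eta :
  eta_identity gamma eta <-> eta \oF recip_quot K = gamma * gammaV.
Proof. by rewrite /eta_identity evalE z_at1B1. Qed.

Lemma H_identityE H :
  H_identity gamma H <->
  fpsX * (H \oF recip_quot K) = gamma - z_at1 * gammaV.
Proof. by rewrite /H_identity evalE z_at1B1. Qed.

(** [recip1] swaps [gamma] and [gammaV], so their product is invariant. *)
Lemma eta_identity_unique : exists! eta : fps K, eta_identity gamma eta.
Proof.
have [|eta etaE] := @recip1_invariant_comp K (gamma * gammaV) two_neq0.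
  by rewrite fps_compM ?recip1_0 // gammaVK mulrC.
exists eta; split=> [|eta' /eta_identityE eta'E]; first exact/eta_identityE.
by apply: fps_comp_recip_quot_inj; rewrite etaE eta'E.
Qed.

(** Under [recip1] the numerator [N] and the denominator [fpsX] are both multiplied by -1/z, so
    their quotient is invariant. *)
Lemma H_identity_unique : exists! H : fps K, H_identity gamma H.
Proof.
have r0 := recip1_0 K; have z_unit := z_at1_unit K.
pose N : fps K := gamma - z_at1 * gammaV.
(* At z = 1 the two terms of [N] cancel, so division by w is exact. *)
have NE : fpsX * fps_shift N = N.
  apply: fps_shiftK.
  by rewrite coef_fpsD coef_fpsN coef_fpsM0 coef_fps_comp0 z_at1_0 mul1r subrr.
have [|H HE] := @recip1_invariant_comp K (fps_shift N) two_neq0.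
  apply: fpsX_lreg; rewrite NE.
  have : N \oF recip1 K = - N / z_at1.
    rewrite fps_compB fps_compM // z_at1_recip1 gammaVK -/gammaV.
    by apply: (mulIr z_unit); rewrite mulrVK // mulrBl mulrAC mulVr // /N; ring.
  rewrite -{1}NE fps_compM // fps_comp_X // {1}recip1E => NrE.
  have nz_unit : - z_at1^-1 \is a @GRing.unit (fps K) by rewrite unitrN unitrV.
  apply: (mulrI nz_unit); rewrite [RHS](_ : _ = - N / z_at1); last by ring.
  rewrite -NrE; ring.
exists H; split=> [|H' /H_identityE H'E]; first by apply/H_identityE; rewrite HE.
by apply: fps_comp_recip_quot_inj; apply: fpsX_lreg; rewrite HE NE H'E.
Qed.

Lemma B_functionE eta H B : eta_identity gamma eta -> H_identity gamma H ->
  is_B_function f B <-> B = H \oF fps_cinv (fpsX / eta).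
Proof.
move=> /eta_identityE etaE /H_identityE HE.
have r0 := recip1_0 K; have z_unit := z_at1_unit K.
have T0 := recip_quot0 K.
(* The constant term is gamma(1)^2; hence [E] below has order one and [fps_cinv E] is a genuine
   inverse. *)
have eta0 : eta 0%N != 0.
  rewrite -(coef_fps_comp0 eta (recip_quot K)) etaE coef_fpsM0 coef_fps_comp0.
  by rewrite mulf_neq0.
pose E : fps K := fpsX / eta.
have E0 : E 0%N = 0 by exact: coef_fpsXM0.
have E1 : E 1%N != 0 by rewrite coef_fpsXM coef_fpsV0 // invr_eq0.
have [EV0 EVK VEK] := fps_cinvP E0 E1.
have ET : E \oF recip_quot K = recip_quot K / (gamma * gammaV).
  by rewrite fps_compM // fps_compV // fps_comp_X // etaE.
have ET0 : (E \oF recip_quot K) 0%N = 0 by rewrite coef_fps_comp0.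
have fP : f \oF P = fpsX / (z_at1 * gammaV).
  rewrite -[f]opprK fps_compN NfE fps_compA // fps_compA // uP fps_comp_id.
  rewrite /P fps_compM // fps_compV // fps_comp_X // -/gammaV recip1E.
  rewrite invrM //; ring.
have fXP : fpsX * f \oF P = E \oF recip_quot K.
  rewrite fps_compXM // fP ET /P /recip_quot !invrM //; ring.
have lhsP : (f - fpsX) \oF P = (E \oF recip_quot K) * (H \oF recip_quot K).
  rewrite fps_compB fP fps_comp_X // ET /P /recip_quot.
  (* One factor w of [recip_quot] is moved next to [H], to expose the left side of the identity
     defining [H]. *)
  rewrite expr2 [RHS](_ : _ = fpsX / (z_at1 * (gamma * gammaV)) *
    (fpsX * (H \oF recip_quot K))); last first.
    by rewrite !invrM ?unitrM ?gamma_unit //; ring.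
  rewrite HE !invrM ?unitrM ?gamma_unit //.
  (* [ring] treats the inverses as atoms, so their cancellation rules are supplied as equations. *)
  have gV := divrr gamma_unit; have gVV := divrr gammaV_unit.
  have zV := divrr z_unit; ring: gV gVV zV.
have rhsP : ((fpsX * B) \oF (fpsX * f)) \oF P =
    (E \oF recip_quot K) * ((B \oF E) \oF recip_quot K).
  rewrite fps_compA ?coef_fpsXM0 // fXP fps_compXM // fps_compA //.
(* Composition with [u] undoes composition with [P], so the equation for [B] may be tested after
   composing with [P]. *)
have P_inj : injective (fun A : fps K => A \oF P).
  move=> A A' /(congr1 (fun A : fps K => A \oF u)).
  by rewrite !fps_compA // Pu !fps_comp_id.
have ET_lreg : GRing.lreg (E \oF recip_quot K).
  rewrite ET; apply: lregM; first exact: recip_quot_lreg.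
  by apply: mulrI; rewrite unitrV unitrM gamma_unit.
rewrite /is_B_function; split=> [/(congr1 (fun A : fps K => A \oF P))|BE].
  rewrite lhsP rhsP => /ET_lreg/fps_comp_recip_quot_inj ->.
  by rewrite fps_compA // EVK fps_comp_id.
apply: P_inj; rewrite lhsP rhsP BE; congr (_ * (_ \oF _)).
by rewrite fps_compA // VEK fps_comp_id.
Qed.

End BFunction.

Theorem theorem4p1 (R : realType) (gamma g f : fps R)
    (gamma1_neq0 : gamma 0%N != 0)
    (g0 : g 0%N = 1)
    (gE : g = 1 + fpsX * eval_at gamma g)
    (fE : f = fpsX * (eval_at gamma g / (g * eval_at gamma g^-1))) :
  pseudo_involution g f /\
  (exists! eta : fps R, eta_identity gamma eta) /\
  (exists! H : fps R, H_identity gamma H) /\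
  (forall eta H : fps R, eta_identity gamma eta -> H_identity gamma H ->
    forall B : fps R, is_B_function f B <-> B = H \oF fps_cinv (fpsX / eta)).
Proof.
have two_neq0 : (2 : R) != 0 by rewrite pnatr_eq0.
split; first exact: (companion_pseudo_involution gamma1_neq0 g0 gE fE).
split; first exact: eta_identity_unique.
split; first exact: H_identity_unique.
by move=> eta H etaE HE B; exact: (B_functionE gamma1_neq0 g0 gE fE).
Qed.
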